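(* Let $m, t, r, a, i$ be positive integers satisfying $m=\binom{t}{r}-a$, where $2i+9\le a\le t-r+1$. Let $G=([t],E)$ be a left-compressed $r$-graph with $m$ edges. Suppose that the least element, in the colex ordering, of $G^c=[t]^{(r)}\setminus E$ is the $r$-set $\{t-r-i+1,\ t-r+1\}\cup\{t-r+3,t-r+4,\ldots,t\}$. Then $\lambda(G)\le \lambda(C_{r,m})$.
   Context: Notation: $[n]=\{1,\ldots,n\}$; for a set $V$, $V^{(r)}$ is the family of all $r$-element subsets of $V$; $\mathbb{N}=\{1,2,3,\ldots\}$. An $r$-graph $G=(V,E)$ consists of a vertex set $V$ and an edge set $E\subseteq V^{(r)}$. Graph-Lagrangian: for an $r$-graph $G$ with vertex set $[n]$ and edge set $E$, and $\vec{x}=(x_1,\ldots,x_n)\in\mathbb{R}^n$, put $\lambda(G,\vec{x})=\sum_{\{i_1,\ldots,i_r\}\in E}x_{i_1}x_{i_2}\cdots x_{i_r}$. The graph-Lagrangian of $G$ is $\lambda(G)=\max\{\lambda(G,\vec{x}) : x_j\ge 0 \text{ for all } j,\ \sum_{j=1}^n x_j=1\}$. Colex ordering: for distinct $A,B\in\mathbb{N}^{(r)}$, $A$ is less than $B$ in the colex ordering if $\max(A\triangle B)\in B$, where $A\triangle B=(A\setminus B)\cup(B\setminus A)$. $C_{r,m}$ denotes the $r$-graph whose edges are the first $m$ sets in the colex ordering of $\mathbb{N}^{(r)}$ (for $m\le\binom{t}{r}$ it may be regarded as an $r$-graph on $[t]$). Left-compressed: an $r$-graph $G=([n],E)$ is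 left-compressed if, whenever $\{j_1<j_2<\cdots<j_r\}\in E$ and $\{i_1<i_2<\cdots<i_r\}\in[n]^{(r)}$ satisfies $i_p\le j_p$ for every $1\le p\le r$, then $\{i_1,\ldots,i_r\}\in E$. *)

(* Defs.v *)
From HB Require Import structures.
From mathcomp Require Import all_boot all_order all_algebra.
From mathcomp Require Import all_classical all_reals all_analysis.

Set Implicit Arguments.
Unset Strict Implicit.
Unset Printing Implicit Defensive.

Import Order.TTheory GRing.Theory Num.Theory.
Import numFieldNormedType.Exports.

(* The vertex set [n] = {1, ..., n} is 'I_n, and the ordinal k stands for the
   vertex k + 1. *)
Definition vlabel n (k : 'I_n) : nat := k.+1.

Definition rsets n (r : nat) : {set {set 'I_n}} :=
  [set A : {set 'I_n} | #|A| == r].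

Definition is_rgraph n (r : nat) (E : {set {set 'I_n}}) : bool :=
  E \subset rsets n r.

Definition compl_rgraph n (r : nat) (E : {set {set 'I_n}}) :
  {set {set 'I_n}} := rsets n r :\: E.

Definition symdiff n (A B : {set 'I_n}) : {set 'I_n} :=
  (A :\: B) :|: (B :\: A).

(* max (A /_\ B) is an element of B; this is false for A = B, where there is
   no maximum. *)
Definition colex_lt n (A B : {set 'I_n}) : bool :=
  [exists k in symdiff A B,
    [forall j in symdiff A B, vlabel j <= vlabel k] && (k \in B)].

Definition colex_least n (F : {set {set 'I_n}}) (A : {set 'I_n}) : bool :=
  (A \in F) && [forall B in F, (B != A) ==> colex_lt A B].

(* C_(r,m) as an r-graph on [n], for m <= 'C(n, r): an r-set is among the first
   m in colex iff fewer than m r-sets precede it.  All r-sets of positive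
   integers preceding a subset of [n] are themselves subsets of [n], so it does
   not matter that only those are counted. *)
Definition colex_rgraph n (r m : nat) : {set {set 'I_n}} :=
  [set A in rsets n r | #|[set B in rsets n r | colex_lt B A]| < m].

(* enum A lists A in increasing order, so position p (from 0) holds the element
   i_(p+1) of A = {i_1 < ... < i_r}. *)
Definition sorted_labels n (A : {set 'I_n}) : seq nat :=
  [seq vlabel k | k <- enum A].

Definition left_compressed n (r : nat) (E : {set {set 'I_n}}) : Prop :=
  forall I J : {set 'I_n}, J \in E -> I \in rsets n r ->
    (forall p : nat, p < r ->
       nth 0 (sorted_labels I) p <= nth 0 (sorted_labels J) p) ->
    I \in E.

Local Open Scope ring_scope.

Definition lagr (R : realType) n (E : {set {set 'I_n}}) (x : 'rV[R]_n) : R :=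
  \sum_(e in E) \prod_(k in e) x ord0 k.

Definition std_simplex (R : realType) n (x : 'rV[R]_n) : Prop :=
  (forall j, 0 <= x ord0 j) /\ \sum_j x ord0 j = 1.

(* The supremum is a maximum whenever n > 0, see lagrangian_max below. *)
Definition lagrangian (R : realType) n (E : {set {set 'I_n}}) : R :=
  sup [set lagr E x | x in [set x : 'rV[R]_n | std_simplex x]]%classic.

Lemma lagr_continuous (R : realType) n (E : {set {set 'I_n}}) :
  continuous (@lagr R n E).
Proof.
rewrite /lagr; apply: (@continuous_big R^o _ +%R) => [|e _].
  exact: add_continuous.
apply: (@continuous_big R^o _ *%R) => [|j _]; first exact: mul_continuous.
exact: coord_continuous.
Qed.

Lemma simplex_compact (R : realType) n :
  compact [set x : 'rV[R]_n | std_simplex x]%classic.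
Proof.
have cK : compact
    [set x : 'rV[R]_n | forall j, `[0, 1]%classic (x ord0 j)]%classic.
  by apply: (@rV_compact R n (fun=> `[0, 1]%classic)) => j;
    exact: segment_compact.
apply: (subclosed_compact _ cK); last first.
  move=> x [x0 x1] j /=; rewrite in_itv /= x0 /= -x1 (bigD1 j) //= lerDl.
  by apply: sumr_ge0.
have -> : [set x : 'rV[R]_n | std_simplex x]%classic =
   ((\bigcap_j ((fun x : 'rV[R]_n => x ord0 j) @^-1` [set y | 0 <= y])) `&`
    ((fun x : 'rV[R]_n => \sum_j x ord0 j) @^-1` [set y | y = 1]))%classic.
  apply/seteqP; split => x /= [x0 x1]; first by split=> // j _; exact: x0.
  by split=> // j; exact: (x0 j).
apply: closedI.
  apply: closed_bigI => j _; apply: preimage_closed; last exact: closed_ge.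
  by move=> x _; exact: coord_continuous.
apply: preimage_closed; last exact: closed_eq.
move=> x _; apply: (@continuous_big R^o _ +%R) => [|j _].
  exact: add_continuous.
exact: coord_continuous.
Qed.

Lemma lagrangian_max (R : realType) n (E : {set {set 'I_n}}) : (0 < n)%N ->
  exists2 x : 'rV[R]_n, std_simplex x &
    lagrangian R E = lagr E x /\ forall y, std_simplex y -> lagr E y <= lagr E x.
Proof.
move=> n0.
have S0 : ([set x : 'rV[R]_n | std_simplex x] !=set0)%classic.
  exists (delta_mx ord0 (Ordinal n0)); split=> [j|].
    by rewrite mxE ler0n.
  rewrite (bigD1 (Ordinal n0)) //= mxE !eqxx big1 ?addr0 // => j jn.
  by rewrite mxE (negPf jn) andbF.
have [|x xS xmax] := EVT_max_rV S0 (@simplex_compact R n) (f := @lagr R n E).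
  by apply: continuous_subspaceT; exact: lagr_continuous.
have {}xmax y : std_simplex y -> lagr E y <= lagr E x.
  by move=> yS; apply: xmax; rewrite inE.
rewrite inE /= in xS.
exists x => //; split=> //; apply/eqP; rewrite eq_le; apply/andP; split.
  apply: ge_sup; first by exists (lagr E x), x.
  by move=> _ [y yS <-]; exact: xmax.
apply: sup_upper_bound; last by exists x.
split; first by exists (lagr E x), x.
by exists (lagr E x) => _ [y yS <-]; exact: xmax.
Qed.

(* Main.v *)
Require Import Defs.
From mathcomp Require Import all_boot all_order all_algebra.
From mathcomp Require Import all_classical all_reals all_analysis.
From mathcomp Require Import perm ring lra zify.

(* Put s = t - r and let T be the set of the r - 2 largest labels.  The least
   non-edge forces every non-edge of G to be T together with a pair, namely
   {k, s+2} for the a - i largest k <= s+1, or {k, s+1} for the i largest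
   k <= s, whereas those of C_(r,m) are the T + {k, s+2} for the a largest
   k <= s+1.  At a decreasing maximizer x of the Lagrangian of G it is then
   enough to show x_(s+2) x_1 <= x_(s+1) x_s unless x_(s+2) or x_T vanishes.
   Otherwise all weights are positive and the first order conditions hold.
   With D_uv the sum of the weights of the (r-2)-sets avoiding u and v, and
   X_2 the sum of the x_k for which only {k, s+2} is missing, they give
     (x_1 - x_s) D_(1,s) = x_T (x_(s+1) + x_(s+2)),
     (x_(s+1) - x_(s+2)) (D_(s+1,s+2) - x_T) = x_T X_2,
   and x_1 <= 2 x_(s+2).  The latter yields D_(s+1,s+2) <= 4 D_(1,s), while
   a >= 2i + 9 yields X_2 >= 8 x_(s+1); hence
   x_(s+1) - x_(s+2) >= x_1 - x_s, which suffices. *)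

Section GraphLagrangian.
Set Implicit Arguments.
Unset Strict Implicit.
Unset Printing Implicit Defensive.

(** * Edge sums under swaps and transfers of weight *)

Section EdgeSums.
Import Order.TTheory GRing.Theory Num.Theory.
Local Open Scope ring_scope.

Variables (R : realFieldType) (n : nat).
Implicit Types (w : 'I_n -> R) (S T K : {set 'I_n}) (F G : {set {set 'I_n}}).
Implicit Types (u v k p q l : 'I_n).

Definition mono w S : R := \prod_(k in S) w k.
Definition edge_sum w F : R := \sum_(e in F) mono w e.

Lemma mono_setU1 w k S : k \notin S -> mono w (k |: S) = w k * mono w S.
Proof. by move=> kS; rewrite /mono big_setU1. Qed.

Lemma mono_ge0 w S : (forall k, 0 <= w k) -> 0 <= mono w S.
Proof. by move=> w0; apply: prodr_ge0. Qed.

Lemma sum_sets_split (P : pred {set 'I_n}) (f : {set 'I_n} -> R) u :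
    (forall S, P (u |: S) = P S) ->
  \sum_(S | P S) f S = \sum_(S | P S && (u \notin S)) (f S + f (u |: S)).
Proof.
move=> PU; rewrite (bigID (fun S => u \in S)) /= addrC big_split /=.
congr (_ + _).
rewrite (reindex_onto (fun S => u |: S) (fun S => S :\ u)) /=; last first.
  by move=> S /andP[_ uS]; rewrite finset.setD1K.
apply: eq_bigl => S; rewrite PU setU11 andbT; congr (_ && _).
apply/eqP/idP => [<-|uS]; first by rewrite !inE eqxx.
by rewrite setU1K.
Qed.

(** Groups the sets by their trace on {u, v}: [S] is the part avoiding both, and the four indicators
    say which extensions of it are in [F]. The dependence on [w u] and [w v] becomes explicit. *)
Lemma edge_sum_split w F u v : u != v ->
  edge_sum w F = \sum_(S : {set 'I_n} | (v \notin S) && (u \notin S)) mono w S *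
    ((S \in F)%:R + w u * (u |: S \in F)%:R + w v * (v |: S \in F)%:R
     + w u * w v * (u |: (v |: S) \in F)%:R).
Proof.
move=> uv; rewrite /edge_sum big_mkcond /=.
rewrite (@sum_sets_split predT _ v) //=.
rewrite (@sum_sets_split _ _ u) => [|S]; last first.
  by rewrite !inE negb_or eq_sym uv.
apply: eq_bigr => S /andP[vS uS].
have uvS : u \notin v |: S by rewrite !inE negb_or uv.
have vuS : v \notin u |: S by rewrite !inE negb_or eq_sym uv.
have -> : v |: (u |: S) = u |: (v |: S) by rewrite finset.setUCA.
rewrite !mono_setU1 //.
by do 4![case: (_ \in F)] => /=; ring.
Qed.

Definition swap w u v k := w (tperm u v k).

Lemma eq_mono w w' S : {in S, w =1 w'} -> mono w S = mono w' S.
Proof. by move=> ww; apply: eq_bigr. Qed.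

(** Only the terms linear in [w u] or [w v] change, and each [S] extended by [v] to an edge is also
    extended by [u], so the larger weight is better placed at [u]. *)
Lemma edge_sum_swap w F u v : (forall k, 0 <= w k) -> u != v -> w u <= w v ->
    (forall S, u \notin S -> v \notin S -> v |: S \in F -> u |: S \in F) ->
  edge_sum w F <= edge_sum (swap w u v) F.
Proof.
move=> w0 uv wuv Fs; rewrite !(@edge_sum_split _ _ u v) //.
apply: ler_sum => S /andP[vS uS].
have -> : mono (swap w u v) S = mono w S.
  apply: eq_mono => k kS; rewrite /swap tpermD //.
    by apply: contraNneq uS => ->.
  by apply: contraNneq vS => ->.
rewrite /swap tpermL tpermR; apply: ler_wpM2l; first exact: mono_ge0.
rewrite [w v * w u]mulrC lerD2r -!addrA lerD2l.
have := Fs _ uS vS; case: (v |: S \in F) => [->//|_]; first by rewrite addrC.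
by rewrite !mulr0 !addr0 ler_wpM2r.
Qed.

Definition transfer w u v (e : R) k :=
  if k == u then w k + e else if k == v then w k - e else w k.

(* The codegree of u and v in the complete r-graph, weighted by w. *)
Definition codeg (r : nat) w u v : R :=
  \sum_(S : {set 'I_n} | [&& v \notin S, u \notin S & (#|S|.+2 == r)%N])
    mono w S.

Lemma mono_transfer w u v e S : u \notin S -> v \notin S ->
  mono (transfer w u v e) S = mono w S.
Proof.
move=> uS vS; apply: eq_mono => k kS; rewrite /transfer.
by rewrite (negPf (memPn uS _ kS)) (negPf (memPn vS _ kS)).
Qed.

(** In the complete r-graph the linear terms depend only on [w u + w v], which is preserved; only
    the product [w u * w v] changes, and its coefficient is the codegree. *)
Lemma edge_sum_rsets_transfer r w u v e : u != v ->
  edge_sum (transfer w u v e) (rsets n r) =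
  edge_sum w (rsets n r) + (e * (w v - w u) - e ^+ 2) * codeg r w u v.
Proof.
move=> uv; rewrite !(@edge_sum_split _ _ u v) //.
have -> : codeg r w u v = \sum_(S : {set 'I_n} | (v \notin S) && (u \notin S))
    mono w S * (#|S|.+2 == r)%N%:R.
  rewrite /codeg [LHS]big_mkcond [RHS]big_mkcond /=; apply: eq_bigr => S _.
  by case: (v \notin S); case: (u \notin S); case: eqP => //=;
    rewrite ?mulr1 ?mulr0.
rewrite mulr_sumr -big_split /=; apply: eq_bigr => S /andP[vS uS].
rewrite mono_transfer // /transfer eqxx eq_sym (negPf uv) eqxx !inE.
have uvS : u \notin v |: S by rewrite !inE negb_or uv.
rewrite !cardsU1 uS vS uvS !add1n; ring.
Qed.

Lemma sum_setU (I : finType) (A B : {set I}) (f : I -> R) : [disjoint A & B] ->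
  \sum_(k in A :|: B) f k = \sum_(k in A) f k + \sum_(k in B) f k.
Proof.
move=> dAB; rewrite -bigU //=; apply: eq_bigl => k.
by rewrite finset.in_setU.
Qed.

Lemma edge_sum_subset w F G : (forall k, 0 <= w k) -> F \subset G ->
  edge_sum w F <= edge_sum w G.
Proof.
move=> w0 FG; rewrite /edge_sum big_mkcond [leRHS]big_mkcond /=.
apply: ler_sum => e _; case eF: (e \in F).
  by rewrite (fintype.subsetP FG _ eF).
by case: ifP => // _; exact: mono_ge0.
Qed.

Lemma edge_sum_setD w F G : G \subset F ->
  edge_sum w (F :\: G) = edge_sum w F - edge_sum w G.
Proof.
move=> GF; apply/eqP; rewrite eq_sym subr_eq; apply/eqP.
rewrite /edge_sum -sum_setU; last first.
  by rewrite finset.disjoints_subset; apply/fintype.subsetP => e;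
    rewrite !inE => /andP[].
apply: eq_bigl => e; rewrite !inE.
by case eG: (e \in G); rewrite ?orbF // (fintype.subsetP GF _ eG).
Qed.

(** * Codegree estimates and the critical inequality *)

Lemma prodr_if_eq_le2 S u : \prod_(k in S) (if k == u then 2 else 1 : R) <= 2.
Proof.
rewrite -big_mkcondr /=; case uS: (u \in S).
  by rewrite (big_pred1 u) // => k /=; case: eqP => [->|]; rewrite ?uS ?andbF.
by rewrite big1 ?ler1n // => k /andP[kS /eqP ku]; rewrite -ku kS in uS.
Qed.

(* The permutation exchanging o with p and l with q maps the sets avoiding p, q
   to those avoiding o, l, and divides the weight by at most 2 * 2. *)
Lemma codeg_le4 r w o l p q : (forall k, 0 <= w k) ->
    o != l -> o != p -> o != q -> l != p -> l != q -> p != q ->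
    w o <= 2 * w p -> w l <= 2 * w q ->
  codeg r w p q <= 4 * codeg r w o l.
Proof.
move=> w0 ol op oq lp lq pq wop wlq.
pose s := (tperm o p * tperm l q)%g.
have so : s o = p by rewrite permM tpermL tpermD // eq_sym.
have sp : s p = o by rewrite permM tpermR tpermD // eq_sym.
have sl : s l = q by rewrite permM [tperm o p l]tpermD ?tpermL // eq_sym.
have sq : s q = l by rewrite permM [tperm o p q]tpermD ?tpermR // eq_sym.
have sk k : k != o -> k != l -> k != p -> k != q -> s k = k.
  by move=> ko kl kp kq; rewrite permM !tpermD // eq_sym.
rewrite /codeg [X in _ <= _ * X](reindex_inj (imset_inj (@perm_inj _ s))) /=.
rewrite mulr_sumr [leRHS](eq_bigl (fun S : {set 'I_n} =>
    [&& q \notin S, p \notin S & (#|S|.+2 == r)%N])) => [|S /=]; last first.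
  by rewrite -[in LHS]sq -[in LHS]sp !(mem_imset _ _ (@perm_inj _ s))
    (card_imset _ (@perm_inj _ s)).
apply: ler_sum => S /and3P[qS pS _].
have -> : mono w [set s x | x in S] = \prod_(k in S) w (s k).
  by rewrite /mono big_imset //= => x y _ _; exact: perm_inj.
have le1 : mono w S <= \prod_(k in S) ((if k == o then 2 else 1) *
    (if k == l then 2 else 1) * w (s k)).
  apply: ler_prod => k kS; rewrite w0 /=.
  have [->|ko] := eqVneq k o; first by rewrite (negPf ol) mulr1 so.
  have [->|kl] := eqVneq k l; first by rewrite mul1r sl.
  by rewrite !mul1r sk //; [move: (memPn pS _ kS)|move: (memPn qS _ kS)].
apply: le_trans le1 _; rewrite !big_split /=.
apply: ler_wpM2r; first exact: prodr_ge0.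
have -> : 4 = 2 * 2 :> R by ring.
by apply: ler_pM; rewrite ?prodr_if_eq_le2 // prodr_ge0 // => k _; case: ifP.
Qed.

(** Replacing [d] in [T] by the various k in [K] gives distinct (r-2)-sets avoiding [u] and [v], so
    their weights are bounded by the codegree; the factor [w d] taken out is at most [w q]. *)
Lemma codeg_ge_exchange r w T K d q u v : (forall k, 0 <= w k) ->
    (#|T|.+2 = r)%N -> u \notin T -> v \notin T -> u \notin K -> v \notin K ->
    [disjoint K & T] -> d \in T -> w d <= w q ->
  mono w T * (\sum_(k in K) w k) <= w q * codeg r w u v.
Proof.
move=> w0 cT uT vT uK vK dKT dT wd.
have kT k : k \in K -> k \notin T by move=> kK; rewrite (disjointFr dKT kK).
rewrite -{1}(finset.setD1K dT) mono_setU1 ?setD11 // -mulrA.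
apply: ler_pM => //; first by rewrite mulr_ge0 ?mono_ge0 ?sumr_ge0.
pose f k := k |: T :\ d.
have finj : {in K &, injective f}.
  move=> x y xK yK /setP /(_ x); rewrite !inE eqxx /= => /esym/orP[/eqP//|].
  by rewrite (negPf (kT _ xK)) andbF.
have -> : mono w (T :\ d) * (\sum_(k in K) w k) = \sum_(S in f @: K) mono w S.
  rewrite big_imset //= mulr_sumr; apply: eq_bigr => k kK.
  by rewrite mono_setU1 1?mulrC // !inE (negPf (kT _ kK)) andbF.
rewrite /codeg big_mkcond [leRHS]big_mkcond /=; apply: ler_sum => S _.
case: imsetP => [[k kK ->]|_]; last by case: ifP => // _; exact: mono_ge0.
rewrite ifT // !inE !negb_or (negPf uT) (negPf vT) !andbF !andbT cardsU1 !inE.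
rewrite (negPf (kT _ kK)) andbF add1n -cT (cardsD1 d T) dT add1n eqxx andbT.
by apply/andP; split; [apply: contraNneq vK => ->|apply: contraNneq uK => ->].
Qed.

Lemma codeg2 w u v : codeg 2 w u v = 1.
Proof.
rewrite /codeg (big_pred1 finset.set0) => [|S /=];
  first by rewrite /mono finset.big_set0.
rewrite !eqSS cards_eq0; case: eqP => [->|]; rewrite ?andbF //.
by rewrite !inE.
Qed.

(* The three equations are the first order conditions at a positive maximizer,
   for the pairs (o, l), (o, q) and (p, q); here o is the label 1, l is s, and
   p, q, T are as in [missing] below. *)
Lemma critical_inequality r w T K2 K3 o l p q :
    (forall k, 0 < w k) -> (#|T|.+2 = r)%N ->
    o != l -> o != p -> o != q -> l != p -> l != q -> p != q ->
    o \notin T -> q \notin T -> p \notin T ->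
    o \notin K2 :|: K3 -> q \notin K2 :|: K3 -> p \notin K2 :|: K3 ->
    [disjoint K2 & K3] -> [disjoint K2 :|: K3 & T] ->
    w l <= w o -> w p <= w l -> w q <= w p -> {in T, forall d, w d <= w q} ->
    4 * (w p + w q) <= \sum_(k in K2) w k ->
    (w o - w l) * codeg r w o l = mono w T * (w p + w q) ->
    (w o - w q) * codeg r w o q =
      mono w T * (\sum_(k in K2) w k + \sum_(k in K3) w k + w p) ->
    (w p - w q) * (codeg r w p q - mono w T) =
      mono w T * (\sum_(k in K2) w k) ->
  w q * w o <= w p * w l.
Proof.
move=> wpos cT ol op oq lp lq pq oT qT pT oK qK pK dK dKT wlo wpl wqp wT X2 De1
  De2 De3.
have w0 k : 0 <= w k by exact: ltW.
have wq := wpos q; have wp := wpos p; have wo := wpos o.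
have xT : 0 < mono w T by apply: prodr_gt0.
have X2pos : 0 < \sum_(k in K2) w k by apply: lt_le_trans X2; lra.
(* By [De3] the product with the nonnegative [w p - w q] is positive, hence so are both factors. *)
have Dpos : 0 < codeg r w p q - mono w T.
  have : 0 < (w p - w q) * (codeg r w p q - mono w T) by rewrite De3 mulr_gt0.
  by rewrite pmulr_rgt0 // lt_neqAle subr_ge0 wqp andbT eq_sym;
    apply/eqP => pq0; move: De3; rewrite pq0 mul0r => /esym/eqP;
      rewrite gt_eqF ?mulr_gt0.
(* If [T] were empty, then r = 2 and both the codegree and [mono w T] would be 1, against [Dpos]. *)
have [d dT] : exists d, d \in T.
  apply/finset.set0Pn/eqP => T0; move: Dpos; rewrite T0 -cT T0 cards0 codeg2.
  by rewrite /mono big_set0 subrr ltxx.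
(* Exchange: x_T <= w q * x_(T - d), and the T - d + k are counted by codeg. *)
have D2 : w o <= 2 * w q.
  have opK : o \notin p |: (K2 :|: K3) by rewrite in_setU1 negb_or op.
  have qpK : q \notin p |: (K2 :|: K3) by rewrite in_setU1 negb_or eq_sym pq.
  have dpK : [disjoint p |: (K2 :|: K3) & T] by rewrite finset.disjoints_subset
    finset.subUset finset.sub1set finset.in_setC pT -finset.disjoints_subset.
  have := codeg_ge_exchange w0 cT oT qT opK qpK dpK dT (wT _ dT).
  rewrite big_setU1 //= sum_setU // [w p + _]addrC -De2.
  (* By [De2] the left side is [(w o - w q) * codeg r w o q]. This codegree cancels: it is positive
     because the right side of [De2] is. *)
  rewrite ler_pM2r ?lerBlDr => [|]; first by move=> ?; lra.
  have := De2; have X3 : 0 <= \sum_(k in K3) w k by apply: sumr_ge0.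
  have c0 : 0 <= codeg r w o q by apply: sumr_ge0 => S _; exact: mono_ge0.
  move=> De; rewrite lt_neqAle c0 andbT eq_sym; apply/eqP => c00.
  move: De; rewrite c00 mulr0 => /esym/eqP; rewrite gt_eqF // mulr_gt0 //; lra.
have D4 : codeg r w p q <= 4 * codeg r w o l.
  by apply: codeg_le4 => //; lra.
(* By [D4] and [De1] the left side is at most 4 x_T (w p + w q), which the bound on the sum over
   [K2] turns into the right side of [De3]. *)
have De : (w o - w l) * (codeg r w p q - mono w T) <=
          (w p - w q) * (codeg r w p q - mono w T).
  rewrite De3; apply: (@le_trans _ _ (4 * ((w o - w l) * codeg r w o l))).
    rewrite mulrCA; apply: ler_wpM2l; first by rewrite subr_ge0.
    by apply: le_trans D4; rewrite lerBlDr lerDl ltW.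
  by rewrite De1 mulrCA ler_pM2l.
move: De; rewrite ler_pM2r // => De.
suff : 0 <= w p * w l - w q * w o by rewrite subr_ge0.
have -> : w p * w l - w q * w o = w o * ((w p - w q) - (w o - w l))
   + (w o - w p) * (w o - w l) by ring.
by apply: addr_ge0; apply: mulr_ge0 => //; lra.
Qed.

Lemma transfer_id w u v e k : k != u -> k != v -> transfer w u v e k = w k.
Proof. by move=> ku kv; rewrite /transfer (negPf ku) (negPf kv). Qed.

Lemma sum_transfer_notin w u v e K : u \notin K -> v \notin K ->
  \sum_(k in K) transfer w u v e k = \sum_(k in K) w k.
Proof.
move=> uK vK; apply: eq_bigr => k kK.
by rewrite transfer_id // (memPn uK _ kK, memPn vK _ kK).
Qed.

Lemma sum_transfer_r w u v e K : u \notin K -> u != v -> v \in K ->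
  \sum_(k in K) transfer w u v e k = \sum_(k in K) w k - e.
Proof.
move=> uK uv vK; rewrite (bigD1 v) // [in RHS](bigD1 v) //= addrAC.
rewrite {1}/transfer eq_sym (negPf uv) eqxx; congr (_ + _).
apply: eq_bigr => k /andP[kK kv]; rewrite transfer_id //;
  exact: (memPn uK _ kK).
Qed.

(** * Stars, the families from which the sets of non-edges are built *)

Definition star u T K : {set {set 'I_n}} := [set u |: (k |: T) | k in K].

Section Star.
Variables (u : 'I_n) (T K : {set 'I_n}).
Hypotheses (uT : u \notin T) (uK : u \notin K) (dKT : [disjoint K & T]).

Let kT k : k \in K -> k \notin T.
Proof. by move=> kK; rewrite (disjointFr dKT kK). Qed.

Let uk k : k \in K -> u \notin k |: T.
Proof. by move=> kK; rewrite !inE negb_or uT andbT;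
  apply: contraNneq (uK) => ->. Qed.

Lemma star_inj : {in K &, injective (fun k => u |: (k |: T))}.
Proof.
move=> x y xK yK /setP /(_ x);
  rewrite !inE eqxx /= orbT => /esym/or3P[/eqP xu|/eqP//|].
  by move: (uK); rewrite -xu xK.
by rewrite (negPf (kT xK)).
Qed.

Lemma card_star : #|star u T K| = #|K|.
Proof. exact: card_in_imset star_inj. Qed.

Lemma edge_sum_star w :
  edge_sum w (star u T K) = mono w T * (w u * \sum_(k in K) w k).
Proof.
rewrite /edge_sum big_imset /=; last exact: star_inj.
rewrite mulr_sumr mulr_sumr; apply: eq_bigr => k kK.
by rewrite !mono_setU1 ?uk ?kT //; ring.
Qed.

Lemma star_rsets r : (#|T|.+2 = r)%N -> star u T K \subset rsets n r.
Proof.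
move=> cT; apply/fintype.subsetP => _ /imsetP[k kK ->].
by rewrite inE !cardsU1 uk ?kT // !add1n cT.
Qed.

End Star.

End EdgeSums.

(** * Left-compression, colex order and intervals of vertices *)

Section Compression.
Import Order.TTheory.

Variables (n r : nat).
Implicit Types (A B S T : {set 'I_n}) (E : {set {set 'I_n}}) (u v k : 'I_n).

Lemma sorted_labels_lt A : sorted ltn (sorted_labels A).
Proof.
have sub : subseq (sorted_labels A) [seq vlabel k | k <- enum 'I_n].
  by apply: map_subseq; rewrite [enum (mem (ordinal n))]enumT;
    exact: filter_subseq.
apply: (subseq_sorted ltn_trans sub).
rewrite /vlabel map_comp val_enum_ord sorted_map; exact: iota_ltn_sorted.
Qed.

Lemma count_sorted_labels (P : pred nat) A :
  count P (sorted_labels A) = \sum_(k in A) P (vlabel k).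
Proof.
by rewrite count_map -sumn_count sumnE big_map big_enum.
Qed.

(** Let c be the label at position p of [v |: S]. Replacing [v] by the smaller [u] cannot lower the
    number of labels at most c, which is p + 1, so the label at position p of [u |: S] is at most
    c. *)
Lemma left_compressed_shift E u v S : is_rgraph r E -> left_compressed r E ->
  u < v -> u \notin S -> v \notin S -> v |: S \in E -> u |: S \in E.
Proof.
move=> Er Ec uv uS vS vE.
have := fintype.subsetP Er _ vE; rewrite inE cardsU1 vS => cS.
apply: (Ec _ _ vE) => [|p pr]; first by rewrite inE cardsU1 uS.
apply: (@Order.PreorderTheory.nth_count_le _ nat).
  exact: sub_sorted (@ltnW) _ (sorted_labels_lt _).
have sz : p < size (sorted_labels (v |: S)).
  by rewrite size_map -cardE cardsU1 vS (eqP cS).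
have := @Order.PreorderTheory.count_le_nth _ nat 0 _ _ (sorted_labels_lt _) sz.
rewrite !count_sorted_labels !big_setU1 //= => <-; rewrite leq_add2r.
set c := nth _ _ _; rewrite !leEnat /vlabel.
by case: (leqP v.+1 c) => // vc; rewrite (leq_trans _ vc) // ltnS ltnW.
Qed.

Lemma compl_rgraph_shift E u v S : is_rgraph r E -> left_compressed r E ->
  u < v -> u \notin S -> v \notin S ->
  u |: S \in compl_rgraph r E -> v |: S \in compl_rgraph r E.
Proof.
move=> Er Ec uv uS vS; rewrite !inE !cardsU1 uS vS => /andP[uE ->].
by rewrite andbT; apply: contraNN uE; exact: left_compressed_shift.
Qed.

(** An element k >= c missing from [B] would lie in the symmetric difference, whose maximum would
    then be at least c and so in both [A] and [B]. *)
Lemma colex_lt_upset A B c : colex_lt A B ->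
  (forall k, c <= k -> k \in A) -> forall k, c <= k -> k \in B.
Proof.
move=> /existsP[m /andP[mD /andP[/forallP mmax mB]]] cA k ck.
apply: contraTT mD => kB; rewrite !inE mB (cA m) //.
have := mmax k; rewrite !inE kB (cA k ck) /= /vlabel ltnS.
exact: leq_trans.
Qed.

Lemma set_star_shape B T u : #|B| = #|T|.+2 -> T \subset B -> u \in B ->
  u \notin T -> exists k, [/\ k \notin T, k != u & B = u |: (k |: T)].
Proof.
move=> cB TB uB uT.
have : #|B :\: (u |: T)| == 1.
  rewrite cardsD (finset.setIidPr _) ?cardsU1 ?uT ?cB; first by apply/eqP; lia.
  by rewrite finset.subUset finset.sub1set uB TB.
case/cards1P => k Bk; exists k.
have : k \in B :\: (u |: T) by rewrite Bk set11.
rewrite !inE negb_or => /andP[/andP[ku kT] kB]; split=> //.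
rewrite -[LHS](finset.setID B (u |: T)) Bk (finset.setIidPr _).
  by rewrite finset.setUC finset.setUCA.
by rewrite finset.subUset finset.sub1set uB TB.
Qed.

Lemma card_rsets : #|rsets n r| = 'C(n, r).
Proof. by rewrite card_draws card_ord. Qed.

Definition ordseg lo hi : {set 'I_n} := [set k : 'I_n | lo <= k < hi].

Lemma in_ordseg k lo hi : (k \in ordseg lo hi) = (lo <= k < hi).
Proof. by rewrite inE. Qed.

Lemma disjoint_ordseg lo hi lo' hi' : hi <= lo' ->
  [disjoint ordseg lo hi & ordseg lo' hi'].
Proof.
move=> h; rewrite finset.disjoints_subset; apply/fintype.subsetP => k.
by rewrite finset.in_setC !in_ordseg; lia.
Qed.

Lemma card_ordseg lo hi : hi <= n -> #|ordseg lo hi| = hi - lo.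
Proof.
move=> hn; rewrite -sum1_card.
rewrite (eq_bigl (fun k : 'I_n => lo <= k < hi)); last by move=> k;
  exact: in_ordseg.
rewrite -(big_mkord (fun j => lo <= j < hi) (fun=> 1)) sum1_count.
have [lh|hl] := leqP lo hi; last first.
  by rewrite (eq_count (a2 := pred0)) ?count_pred0; [|move=> j /=]; lia.
have -> : index_iota 0 n = iota 0 lo ++ iota lo (hi - lo) ++ iota hi (n - hi).
  have -> : index_iota 0 n = iota 0 (lo + (hi - lo + (n - hi))).
    by congr iota; lia.
  by rewrite !iotaD add0n subnKC.
rewrite !count_cat.
rewrite (eq_in_count (a2 := pred0)) ?count_pred0; last first.
  by move=> j /=; rewrite mem_iota; lia.
rewrite (eq_in_count (a2 := predT)) ?count_predT ?size_iota; last first.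
  by move=> j /=; rewrite mem_iota; lia.
rewrite (eq_in_count (a2 := pred0)) ?count_pred0 ?addn0 //.
by move=> j /=; rewrite mem_iota; lia.
Qed.

End Compression.

(** * First order conditions and sorted maximizers *)

Section Optimum.
Import Order.TTheory GRing.Theory Num.Theory.
Local Open Scope ring_scope.

Variables (R : realType) (n : nat).
Implicit Types (E : {set {set 'I_n}}) (x : 'rV[R]_n) (u v : 'I_n).

Lemma coef0_of_local_max (c D d : R) : 0 < d ->
  (forall e, `|e| <= d -> e * c - e ^+ 2 * D <= 0) -> c = 0.
Proof.
move=> d0 H.
suff npos b : (forall e, `|e| <= d -> e * b - e ^+ 2 * D <= 0) -> b <= 0.
  apply/le_anti; rewrite npos //= -oppr_le0 npos // => e ed.
  by have := H (- e); rewrite normrN sqrrN mulNr mulrN; exact.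
move=> {c}H; rewrite leNgt; apply/negP => bpos.
pose D' := `|D| + 1.
have D'0 : 0 < D' by rewrite /D' ltr_wpDl.
(* Small enough that the quadratic term costs at most half of the linear gain; the 1 added in [D']
   covers D = 0. *)
pose e := Num.min d (b / (2 * D')).
have bD0 : 0 < b / (2 * D') by rewrite divr_gt0 // mulr_gt0.
have e0 : 0 < e by rewrite lt_min d0.
have ed : `|e| <= d by rewrite gtr0_norm // ge_min lexx.
have := H e ed; rewrite expr2 -mulrA -mulrBr pmulr_rle0 // subr_le0 => beD.
have : e * D <= b / 2.
  apply: (@le_trans _ _ (e * D'));
    first by rewrite ler_pM2l // /D' ler_wpDr // ler_norm.
  apply: (@le_trans _ _ (b / (2 * D') * D')).
    by rewrite ler_pM2r // ge_min lexx orbT.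
  by rewrite invfM mulrA divfK ?gt_eqF.
lra.
Qed.

Lemma lagr_row E (w : 'I_n -> R) : lagr E (\row_k w k) = edge_sum w E.
Proof.
by apply: eq_bigr => e _; apply: eq_bigr => k _; rewrite mxE.
Qed.

(** Since both weights are positive, small transfers in either direction stay in the simplex, so the
    linear coefficient in [e] must vanish at a maximizer. *)
Lemma first_order E x u v (c D : R) : std_simplex x ->
    (forall y : 'rV[R]_n, std_simplex y -> lagr E y <= lagr E x) -> u != v ->
    0 < x ord0 u -> 0 < x ord0 v ->
    (forall e, edge_sum (transfer (x ord0) u v e) E =
               edge_sum (x ord0) E + (e * c - e ^+ 2 * D)) ->
  c = 0.
Proof.
move=> [x0 x1] xmax uv xu xv Hc.
apply: (@coef0_of_local_max c D (Num.min (x ord0 u) (x ord0 v))).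
  by rewrite lt_min xu.
move=> e; rewrite le_min => /andP[eu ev].
have := xmax (\row_k transfer (x ord0) u v e k) _.
rewrite lagr_row Hc gerDl; apply; split=> [j|].
  rewrite mxE /transfer; case: eqP => [->|_]; first by move: eu;
    rewrite ler_norml; lra.
  by case: eqP => [->|_] //; move: ev; rewrite ler_norml; lra.
rewrite -x1; under eq_bigr do rewrite mxE.
rewrite (bigD1 u) // (bigD1 v) 1?eq_sym //= [RHS](bigD1 u) //.
rewrite [in RHS](bigD1 v) 1?eq_sym //=.
rewrite {1 2}/transfer !eqxx eq_sym (negPf uv).
rewrite (eq_bigr (x ord0)) => [|k /andP[ku kv]]; last by rewrite transfer_id.
ring.
Qed.

(* Among the maximizers obtained by permuting a given one, one minimizing the
   sum of the k * x_k is sorted, since a compressing transposition would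
   decrease this sum. *)
Lemma lagrangian_max_sorted E : (0 < n)%N ->
    (forall u v (S : {set 'I_n}), (u < v)%N -> u \notin S -> v \notin S ->
      v |: S \in E -> u |: S \in E) ->
  exists x : 'rV[R]_n, [/\ std_simplex x, lagrangian R E = lagr E x,
    forall y : 'rV[R]_n, std_simplex y -> lagr E y <= lagr E x &
    forall u v, (u <= v)%N -> x ord0 v <= x ord0 u].
Proof.
move=> n0 Es; have [z [z0 z1] [Ez zmax]] := lagrangian_max R E n0.
pose f (s : {perm 'I_n}) k := z ord0 (s k).
pose opt s := edge_sum (f s) E == lagr E z.
pose mu s := \sum_(k : 'I_n) (k : nat)%:R * f s k.
have opt1 : opt 1%g.
  by apply/eqP; apply: eq_bigr => e _; apply: eq_bigr => k _; rewrite /f perm1.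
have simp s : std_simplex (\row_k f s k).
  split=> [j|]; first by rewrite mxE; exact: z0.
  by under eq_bigr do rewrite mxE;
    rewrite -z1 [RHS](reindex_inj (@perm_inj _ s)).
case: (@Order.TotalTheory.arg_minP _ _ {perm 'I_n} 1%g opt mu opt1) =>
  s /eqP os smin.
exists (\row_k f s k); rewrite lagr_row os; split=> // u v uv; rewrite !mxE.
rewrite leNgt; apply/negP => fuv.
have {}uv : (u < v)%N.
  by rewrite ltn_neqAle uv andbT; apply: contraTneq fuv => /val_inj ->;
    rewrite ltxx.
have uNv : u != v by apply: contraTneq uv => ->; rewrite ltnn.
pose s' := (tperm u v * s)%g.
have fs' : f s' =1 swap (f s) u v by move=> k; rewrite /f /swap permM.
have os' : opt s'.
  apply/eqP/le_anti; rewrite -{1}lagr_row zmax //= -os.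
  have -> : edge_sum (f s') E = edge_sum (swap (f s) u v) E.
    by apply: eq_bigr => e _; apply: eq_mono => k _; exact: fs'.
  apply: edge_sum_swap => //; first by move=> k; exact: z0.
    exact: ltW.
  by move=> S uS vS; exact: Es.
have := smin s' os'; apply/negP; rewrite -ltNge /mu.
rewrite (bigD1 u) // (bigD1 v) 1?eq_sym //= [ltRHS](bigD1 u) //.
rewrite [in ltRHS](bigD1 v) 1?eq_sym //=.
rewrite (eq_bigr (fun k : 'I_n => (k : nat)%:R * f s k)) => [|k /andP[ku kv]];
  last first.
  by rewrite fs' /swap tpermD // eq_sym.
rewrite !addrA ltrD2r !fs' /swap tpermL tpermR -subr_gt0.
have -> : u%:R * f s u + v%:R * f s v - (u%:R * f s v + v%:R * f s u) =
  (v%:R - u%:R) * (f s v - f s u) by ring.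
by rewrite mulr_gt0 // subr_gt0 // ltr_nat.
Qed.

End Optimum.

(** * The non-edges of G and of C_(r,m) *)

Section Structure.

Variables (t r s : nat) (p q : 'I_t).
Hypotheses (tE : t = s + r) (r2 : 1 < r) (pE : p = s :> nat)
  (qE : q = s.+1 :> nat).

(* With 0-based ordinals, p and q are the labels s + 1 and s + 2, and [top] is
   the set of labels from s + 3 to t. *)
Definition top := ordseg t s.+2 t.

(** The bound [s.+1] admits [p] in the first interval, while the second stops below [p]: the set {p,
    q} + top belongs to the star of [q] only. *)
Definition missing a i : {set {set 'I_t}} :=
  star q top (ordseg t (s.+1 - (a - i)) s.+1) :|:
  star p top (ordseg t (s - i) s).

Lemma card_top : #|top|.+2 = r.
Proof. by rewrite card_ordseg //; lia. Qed.

Lemma q_top : q \notin top. Proof. by rewrite in_ordseg qE; lia. Qed.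
Lemma p_top : p \notin top. Proof. by rewrite in_ordseg pE; lia. Qed.

Lemma disjoint_stars (K K' : {set 'I_t}) :
    [disjoint K & top] -> [disjoint K' & top] -> q \notin K' ->
  [disjoint star q top K & star p top K'].
Proof.
move=> dK dK' qK'; rewrite finset.disjoints_subset; apply/fintype.subsetP => B.
rewrite finset.in_setC => /imsetP[k kK ->];
  apply/imsetP => -[k' kK' /finset.setP /(_ q)].
rewrite !inE eqxx /= => /esym/or3P[/eqP qp|/eqP qk|].
- by move: qE; rewrite qp pE; lia.
- by move: qK'; rewrite qk kK'.
by rewrite qE; lia.
Qed.

Lemma missing_sub_rsets a i : missing a i \subset rsets t r.
Proof.
rewrite finset.subUset; apply/andP; split; apply: star_rsets;
  rewrite ?card_top ?q_top ?p_top ?in_ordseg ?pE ?qE ?disjoint_ordseg //; lia.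
Qed.

Lemma card_missing a i : i <= a <= s.+1 -> i <= s -> #|missing a i| = a.
Proof.
move=> ia il; rewrite cardsU disjoint_setI0; last first.
  by apply: disjoint_stars; rewrite ?disjoint_ordseg ?in_ordseg ?qE //; lia.
rewrite finset.cards0 subn0 !card_star ?q_top ?p_top ?in_ordseg ?pE ?qE
  ?disjoint_ordseg //;
  rewrite ?card_ordseg; lia.
Qed.

(** Non-edges are colex above {p, b} + top, so they contain [top] and lie in the star of [q] over
    [Q] or in that of [p] over the [i] vertices from [b] to s - 1. Counting gives [Q] at least a - i
    elements, compression makes both stars closed upward, and the cardinality [a] forces
    equality. *)
Lemma compl_rgraph_missing a i (E : {set {set 'I_t}}) (b : 'I_t) :
    0 < i <= a -> a <= s.+1 -> i <= s -> b = s - i :> nat ->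
    is_rgraph r E -> left_compressed r E -> #|compl_rgraph r E| = a ->
    colex_least (compl_rgraph r E) (p |: (b |: top)) ->
  compl_rgraph r E = missing a i.
Proof.
move=> ia ale il bE Er Ec cX /andP[AX /forallP Amin].
have bp : b != p by rewrite -val_eqE /= bE pE; lia.
have bT : b \notin top by rewrite in_ordseg bE; lia.
set X := compl_rgraph r E in cX AX Amin *.
pose Q := [set k in ordseg t 0 s.+1 | q |: (k |: top) \in X].
have cR B : B \in X -> #|B| = #|top|.+2.
  by rewrite card_top !inE => /andP[_ /eqP].
have topk (k : 'I_t) : s.+2 <= k -> k \in top by rewrite in_ordseg ltn_ord
  andbT.
have XQ : X \subset star q top Q :|: star p top (ordseg t (s - i) s).
  apply/fintype.subsetP => B BX; rewrite finset.in_setU; apply/orP.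
  have [->|BA] := eqVneq B (p |: (b |: top)).
    by right; apply/imsetP; exists b; rewrite // in_ordseg bE; lia.
  have AB : colex_lt (p |: (b |: top)) B.
    by have := Amin B; rewrite BX BA.
  have TB : top \subset B.
    apply/fintype.subsetP => k; rewrite in_ordseg => /andP[kt _].
    by apply: (colex_lt_upset AB _ kt) => j /topk jt;
      rewrite !in_setU1 jt !orbT.
  have [qB|qB] := boolP (q \in B).
    have [k [kT kq Bk]] := set_star_shape (cR _ BX) TB qB q_top.
    left; apply/imsetP; exists k => //; rewrite inE -Bk BX andbT in_ordseg.
    by move: kT kq; rewrite in_ordseg -val_eqE /= qE; have := ltn_ord k; lia.
  have /existsP[m /andP[mD /andP[/forallP mmax mB]]] := AB.
  have mA : m \notin p |: (b |: top).
    by move: mD; rewrite /symdiff finset.in_setU !finset.in_setD mB /= andbT.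
  have ms : m <= s.
    move: mA; rewrite !inE !negb_or => /and3P[_ _];
      rewrite ltn_ord andbT -leqNgt.
    have : m != q by apply: contraNneq qB => <-.
    by rewrite -val_eqE /= qE; clear; lia.
  (* Otherwise [p] lies in the symmetric difference, so m >= s; with [ms] this gives m = p, yet m is
     in [B]. *)
  have pB : p \in B.
    apply: contraTT (mmax p) => pB; rewrite !inE eqxx pB /= /vlabel pE.
    have : m != p by apply: contraNneq pB => <-.
    by rewrite -val_eqE /= pE; lia.
  have [k [kT kp Bk]] := set_star_shape (cR _ BX) TB pB p_top.
  right; apply/imsetP; exists k => //.
  have bk : b != k by apply: contraNneq BA => ->; rewrite Bk.
  (* The maximum [m] is in [B] but not in {p, b} + top, so it is the free element [k]; as [b] is
     also in the symmetric difference, b <= k. *)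
  have mk : m = k.
    move: mB mA; rewrite Bk !in_setU1 => /or3P[/eqP->|/eqP//|->];
      rewrite ?eqxx //.
    by rewrite !orbT.
  have bB : b \notin B.
    by rewrite Bk !in_setU1 !negb_or bk bp bT.
  have := mmax b; rewrite !inE eqxx orbT (negPf bB) /= /vlabel mk bE.
  move: kT kp; rewrite in_ordseg -val_eqE /= pE; move: ms; rewrite mk.
  by have := ltn_ord k; clear; lia.
have cQ : a - i <= #|Q|.
  have := leq_trans (subset_leq_card XQ) (leq_card_setU _ _).
  rewrite cX card_star ?q_top ?disjoint_ordseg //; last first.
  - by apply: disjointWl (disjoint_ordseg _ 0 t (leqnn s.+2));
    apply/fintype.subsetP => k; rewrite !inE; lia.
  - by rewrite inE in_ordseg qE; lia.
  by rewrite card_star ?p_top ?in_ordseg ?pE ?disjoint_ordseg ?card_ordseg; lia.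
(* If [k] is not in [Q], compression puts all of [Q] above [k], leaving room for fewer than a - i
   elements. *)
have Qup : ordseg t (s.+1 - (a - i)) s.+1 \subset Q.
  apply/fintype.subsetP => k; rewrite in_ordseg => /andP[k1 k2].
  apply: contraLR cQ => kQ; rewrite -ltnNge.
  have /subset_leq_card : Q \subset ordseg t k.+1 s.+1.
    apply/fintype.subsetP => j; rewrite inE !in_ordseg => /andP[/andP[_ js] jX].
    rewrite js andbT ltnNge; apply: contra kQ => kj'.
    rewrite inE in_ordseg k2 /=; move: jX.
    have [->//|jk] := eqVneq j k.
    rewrite finset.setUCA [in X in _ -> X]finset.setUCA;
      apply: compl_rgraph_shift => //.
    - by rewrite ltn_neqAle val_eqE jk.
    - by rewrite !inE -val_eqE /= qE; lia.
    - by rewrite !inE -val_eqE /= qE; lia.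
  by rewrite card_ordseg; lia.
apply/esym/eqP; rewrite eqEcard cX card_missing ?leqnn ?andbT; try lia.
rewrite finset.subUset; apply/andP; split;
  apply/fintype.subsetP => _ /imsetP[k kK ->].
  by have := fintype.subsetP Qup _ kK; rewrite inE => /andP[].
have [->|kb] := eqVneq k b; first exact: AX.
move: kK; rewrite in_ordseg => /andP[k1 k2].
move: AX; rewrite finset.setUCA [in X in _ -> X]finset.setUCA;
  apply: compl_rgraph_shift => //.
- by rewrite ltn_neqAle val_eqE eq_sym kb bE.
- by rewrite !inE -val_eqE /= bE pE; lia.
- by rewrite !inE -val_eqE /= pE; lia.
Qed.

(* This is an equality, but only the inclusion matters: it bounds the Lagrangian
   of C_(r,m) from below. *)
Lemma colex_rgraph_sup a : a <= s.+1 -> a <= 'C(t, r) ->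
  rsets t r :\: star q top (ordseg t (s.+1 - a) s.+1) \subset
  colex_rgraph t r ('C(t, r) - a).
Proof.
move=> ale aC; set N := star _ _ _.
have NR : N \subset rsets t r.
  by apply: star_rsets;
    rewrite ?card_top ?q_top ?in_ordseg ?qE ?disjoint_ordseg //; lia.
have cN : #|N| = a.
  by rewrite card_star ?q_top ?in_ordseg ?qE ?disjoint_ordseg ?card_ordseg //;
    lia.
apply/fintype.subsetP => A; rewrite inE => /andP[AN AR]; rewrite inE AR /=.
set P := [set B in _ | _].
(* The predecessors of [A] avoid [N] and do not include [A] itself, so there are fewer than 'C(t, r)
   - a of them. *)
have : P \proper rsets t r :\: N.
  apply/fintype.properP; split; last first.
    exists A; first by rewrite inE AN.
    rewrite inE AR /=; apply/negP => /existsP[k /andP[]].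
    by rewrite /symdiff finset.setDv finset.setU0 inE.
  apply/fintype.subsetP => B; rewrite !inE => /andP[BR BA]; rewrite BR andbT.
  (* [N] is closed upward in colex: a successor [A] of [B] in [N] keeps [q] and [top], and its
     remaining element j is at least k. *)
  apply: contra AN => /imsetP[k]; rewrite in_ordseg => /andP[k1 k2] BE.
  have TA : forall j : 'I_t, s.+1 <= j -> j \in A.
    apply: (colex_lt_upset BA) => j js;
      rewrite BE !inE ltn_ord andbT -val_eqE /= qE.
    by move: js; rewrite leq_eqVlt eq_sym => /orP[->//|->]; rewrite !orbT.
  have TsA : top \subset A.
    by apply/fintype.subsetP => j; rewrite in_ordseg => /andP[jt _]; apply: TA;
      lia.
  have qA : q \in A by apply: TA; rewrite qE.
  have cA : #|A| = #|top|.+2 by move: AR; rewrite card_top inE => /eqP.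
  have [j [jT jq Aj]] := set_star_shape cA TsA qA q_top.
  apply/imsetP; exists j => //; rewrite in_ordseg.
  have js : j < s.+1.
    by move: jT jq; rewrite in_ordseg -val_eqE /= qE; have := ltn_ord j; lia.
  rewrite js andbT; apply: (leq_trans k1).
  have /existsP[m /andP[mD /andP[/forallP mmax mA]]] := BA.
  have mB : m \notin B by move: mD;
    rewrite /symdiff finset.in_setU !finset.in_setD mA /= andbT.
  have mj : m = j.
    move: mA mB; rewrite Aj BE !in_setU1 => /or3P[/eqP->|/eqP//|->];
      rewrite ?eqxx //.
    by rewrite !orbT.
  rewrite leqNgt; apply/negP => jk.
  have kA : k \notin A.
    rewrite Aj !in_setU1 in_ordseg -!val_eqE /= qE.
    by move: jk k2; clear; lia.
  have kB : k \in B by rewrite BE !in_setU1 eqxx orbT.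
  by have := mmax k; rewrite !inE kA kB /= /vlabel mj ltnS leqNgt jk.
move/proper_card; rewrite cardsD (finset.setIidPr NR) cN card_rsets => h.
exact: h.
Qed.


(** * Comparing the two edge sums at a sorted maximizer *)

Section Comparison.
Import Order.TTheory GRing.Theory Num.Theory.
Local Open Scope ring_scope.
Variables (R : realType) (a i : nat).
Hypotheses (i_gt0 : (0 < i)%N) (ha : (2 * i + 9 <= a <= s.+1)%N).
Implicit Types (w : 'I_t -> R).

Let T := top.
(** For k in [K2] only {k, q} + T is missing; for k in [K3] both {k, q} + T and {k, p} + T are. *)
Let K2 := ordseg t (s.+1 - (a - i)) (s - i).
Let K3 := ordseg t (s - i) s.

Lemma sum_ordseg_cat w lo mid hi : (lo <= mid <= hi)%N ->
  \sum_(k in ordseg t lo hi) w k =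
  \sum_(k in ordseg t lo mid) w k + \sum_(k in ordseg t mid hi) w k.
Proof.
move=> /andP[lm mh]; rewrite -sum_setU ?disjoint_ordseg //; apply: eq_bigl => k.
by rewrite finset.in_setU !in_ordseg; move: lm mh; clear; lia.
Qed.

Lemma ordseg_p : ordseg t s s.+1 = [set p]%SET.
Proof. by apply/finset.setP => k;
  rewrite in_ordseg finset.in_set1 -val_eqE /= pE; clear; lia. Qed.

Lemma edge_sum_compl_missing w :
  edge_sum w (rsets t r :\: missing a i) = edge_sum w (rsets t r) -
    mono w T * (w q * (\sum_(k in K2) w k + \sum_(k in K3) w k + w p) +
                w p * \sum_(k in K3) w k).
Proof.
rewrite edge_sum_setD; last exact: missing_sub_rsets.
congr (_ - _); rewrite /missing /edge_sum sum_setU; last first.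
  by apply: disjoint_stars; rewrite ?disjoint_ordseg ?in_ordseg ?qE //; lia.
rewrite -!/(edge_sum w _) !edge_sum_star ?q_top ?p_top ?in_ordseg ?pE ?qE
  ?disjoint_ordseg //; try lia.
rewrite mulrDr; congr (_ * (_ * _) + _).
rewrite (@sum_ordseg_cat w _ s); last lia.
rewrite (@sum_ordseg_cat w _ (s - i)); last lia.
by rewrite ordseg_p finset.big_set1.
Qed.

(** After common non-edges cancel, [w q] times [i] weights, each at most [w o], is compared with
    [w p] times the [i] weights of [K3], each at least [w l]. *)
Lemma lagr_missing_le (x : 'rV[R]_t) (E := rsets t r :\: missing a i) :
    std_simplex x ->
    (forall y : 'rV[R]_t, std_simplex y -> lagr E y <= lagr E x) ->
    (forall u v : 'I_t, (u <= v)%N -> x ord0 v <= x ord0 u) ->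
  lagr E x <= lagr (rsets t r :\: star q T (ordseg t (s.+1 - a) s.+1)) x.
Proof.
move=> xS xmax xsort; set w := x ord0.
have w0 k : 0 <= w k by case: xS.
have st : (s.+1 < t)%N by lia.
pose o := Ordinal (leq_ltn_trans (leq0n _) st).
pose l := Ordinal (leq_ltn_trans (leq_trans (leq_pred s) (leqnSn s)) st).
have Kcat : \sum_(k in ordseg t (s.+1 - a) s.+1) w k =
    \sum_(k in ordseg t (s.+1 - a) (s.+1 - (a - i))) w k +
    (\sum_(k in K2) w k + \sum_(k in K3) w k + w p).
  rewrite (@sum_ordseg_cat w _ (s.+1 - (a - i))); last lia.
  rewrite (@sum_ordseg_cat w _ s s.+1); last lia.
  rewrite (@sum_ordseg_cat w _ (s - i) s); last lia.
  by rewrite ordseg_p finset.big_set1.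
have -> : lagr E x = edge_sum w E by [].
rewrite -[lagr _ x]/(edge_sum w _) edge_sum_compl_missing edge_sum_setD;
  last first.
  by apply: star_rsets;
    rewrite ?card_top ?q_top ?in_ordseg ?qE ?disjoint_ordseg //; lia.
rewrite edge_sum_star ?q_top ?in_ordseg ?qE ?disjoint_ordseg //; try lia.
have T0 : 0 <= mono w T by exact: mono_ge0.
rewrite lerD2l lerN2 Kcat.
have [->|Tn0] := eqVneq (mono w T) 0; first by rewrite !mul0r.
have Tpos : 0 < mono w T by rewrite lt_neqAle eq_sym Tn0.
rewrite ler_wpM2l // mulrDr addrC lerD2l.
have KA : \sum_(k in ordseg t (s.+1 - a) (s.+1 - (a - i))) w k <= i%:R * w o.
  apply: (@le_trans _ _ (\sum_(k in ordseg t (s.+1 - a) (s.+1 - (a - i))) w o)).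
    by apply: ler_sum => k _; exact: xsort.
  rewrite sumr_const mulr_natl card_ordseg; last lia.
  by rewrite (_ : (s.+1 - (a - i) - (s.+1 - a) = i)%N) //; lia.
have KB : i%:R * w l <= \sum_(k in K3) w k.
  apply: (@le_trans _ _ (\sum_(k in K3) w l)).
    rewrite sumr_const mulr_natl card_ordseg; last lia.
    by rewrite (_ : (s - (s - i) = i)%N) //; lia.
  by apply: ler_sum => k; rewrite in_ordseg => /andP[_ ks]; apply: xsort => /=;
    lia.
suff main : w q * w o <= w p * w l.
  apply: (@le_trans _ _ (i%:R * (w q * w o))).
    by rewrite mulrCA; exact: ler_wpM2l.
  apply: (@le_trans _ _ (i%:R * (w p * w l))); first exact: ler_wpM2l.
  by rewrite mulrCA; exact: ler_wpM2l.
have [->|qn0] := eqVneq (w q) 0; first by rewrite mul0r mulr_ge0.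
have wq : 0 < w q by rewrite lt_neqAle eq_sym qn0 w0.
(* Vertices up to [q] weigh at least [w q]; those beyond lie in [T], where a zero weight would make
   [mono w T] vanish. *)
have wpos k : 0 < w k.
  have [kq|qk] := leqP k q; first by apply: lt_le_trans wq _; exact: xsort.
  rewrite lt_neqAle w0 andbT eq_sym; apply: contra Tn0 => /eqP wk.
  have kT : k \in T by rewrite in_ordseg -qE qk ltn_ord.
  by rewrite /mono (bigD1 k) //= wk mul0r.
have ol : o != l by rewrite -val_eqE /=; move: (ha) (i_gt0); clear; lia.
have op : o != p by rewrite -val_eqE /= pE; move: (ha) (i_gt0); clear; lia.
have oq : o != q by rewrite -val_eqE /= qE; move: (ha) (i_gt0); clear; lia.
have lp : l != p by rewrite -val_eqE /= pE; move: (ha) (i_gt0); clear; lia.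
have lq : l != q by rewrite -val_eqE /= qE; move: (ha) (i_gt0); clear; lia.
have pq : p != q by rewrite -val_eqE /= qE pE; move: (ha) (i_gt0); clear; lia.
have oT : o \notin T by rewrite in_ordseg /=; move: (ha) (i_gt0); clear; lia.
have lT : l \notin T by rewrite in_ordseg /=; move: (ha) (i_gt0); clear; lia.
have oK2 : o \notin K2 by rewrite in_ordseg /=; move: (ha) (i_gt0); clear; lia.
have oK3 : o \notin K3 by rewrite in_ordseg /=; move: (ha) (i_gt0); clear; lia.
have pK2 : p \notin K2 by rewrite in_ordseg pE; move: (ha) (i_gt0); clear; lia.
have pK3 : p \notin K3 by rewrite in_ordseg pE; move: (ha) (i_gt0); clear; lia.
have qK2 : q \notin K2 by rewrite in_ordseg qE; move: (ha) (i_gt0); clear; lia.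
have qK3 : q \notin K3 by rewrite in_ordseg qE; move: (ha) (i_gt0); clear; lia.
have lK2 : l \notin K2 by rewrite in_ordseg /=; move: (ha) (i_gt0); clear; lia.
have lK3 : l \in K3 by rewrite in_ordseg /=; move: (ha) (i_gt0); clear; lia.
(* [K2] has a - 2i - 1 >= 8 elements, each of weight at least [w p]; this is where the 9 in the
   bound on [a] enters. *)
have X2 : 4 * (w p + w q) <= \sum_(k in K2) w k.
  apply: (@le_trans _ _ (\sum_(k in K2) w p)).
    rewrite sumr_const card_ordseg ?(leq_trans (leq_subr _ _) (ltnW (ltnW st)))
      //.
    apply: (@le_trans _ _ (w p *+ 8)); last by apply: ler_wpMn2l => //;
      move: (ha) (i_gt0); clear; lia.
    rewrite -mulr_natl; have : w q <= w p by apply: xsort; rewrite pE qE.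
    lra.
  by apply: ler_sum => k; rewrite in_ordseg => /andP[_ ks]; apply: xsort;
    rewrite pE; move: ks; clear; lia.
apply: (@critical_inequality _ _ r w T K2 K3 o l p q) => //.
- exact: card_top.
- exact: q_top.
- exact: p_top.
- by rewrite finset.in_setU negb_or oK2.
- by rewrite finset.in_setU negb_or qK2.
- by rewrite finset.in_setU negb_or pK2.
- exact: disjoint_ordseg.
- by rewrite finset.disjoints_subset finset.subUset -!finset.disjoints_subset
  !disjoint_ordseg //; move: (ha) (i_gt0); clear; lia.
- exact: xsort.
- by apply: xsort; rewrite /= pE leq_pred.
- by apply: xsort; rewrite qE pE.
- by move=> d; rewrite in_ordseg => /andP[sd _]; apply: xsort; rewrite qE ltnW.
- have : (w l - w o) * codeg r w o l + mono w T * (w q + w p) = 0.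
    apply: (@first_order _ _ E x o l _ (codeg r w o l)) => // e.
    rewrite -/w !edge_sum_compl_missing edge_sum_rsets_transfer //
      mono_transfer //.
    rewrite (sum_transfer_notin _ _ oK2 lK2) (sum_transfer_r _ _ oK3 ol lK3).
    by rewrite !transfer_id 1?eq_sym //; ring.
  by move=> h; apply/eqP; rewrite -subr_eq0 -oppr_eq0; apply/eqP;
    rewrite -[RHS]h; ring.
- have : (w q - w o) * codeg r w o q + mono w T * (\sum_(k in K2) w k + \sum_(k
  in K3) w k + w p) = 0.
    apply: (@first_order _ _ E x o q _ (codeg r w o q)) => // e.
    rewrite -/w !edge_sum_compl_missing edge_sum_rsets_transfer //
      mono_transfer ?q_top //.
    rewrite (sum_transfer_notin _ _ oK2 qK2) (sum_transfer_notin _ _ oK3 qK3).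
    by rewrite [transfer _ _ _ _ p]transfer_id 1?[p == o]eq_sym // /transfer [q
      == o]eq_sym (negPf oq) eqxx; ring.
  by move=> h; apply/eqP; rewrite -subr_eq0 -oppr_eq0; apply/eqP;
    rewrite -[RHS]h; ring.
(* {p, q} + T is itself missing, which lowers the quadratic coefficient by [mono w T]; the [K3]
   terms cancel, since each such k misses both [p] and [q]. *)
- have : (w q - w p) * codeg r w p q - mono w T * (w q - \sum_(k in K2) w k - w
  p) = 0.
    apply: (@first_order _ _ E x p q _ (codeg r w p q - mono w T)) => // e.
    rewrite -/w !edge_sum_compl_missing edge_sum_rsets_transfer //
      mono_transfer ?q_top ?p_top //.
    rewrite (sum_transfer_notin _ _ pK2 qK2) (sum_transfer_notin _ _ pK3 qK3).
    by rewrite /transfer !eqxx [q == p]eq_sym (negPf pq); ring.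
  by move=> h; apply/eqP; rewrite -subr_eq0 -oppr_eq0; apply/eqP;
    rewrite -[RHS]h; ring.
Qed.


End Comparison.
End Structure.

End GraphLagrangian.

(** * Translation to zero-based vertices and evaluation of both graphs at one sorted maximizer *)

Theorem theorem1p5 (R : realType) (m t r a i : nat)
  (m_gt0 : 0 < m) (t_gt0 : 0 < t) (r_gt0 : 0 < r) (a_gt0 : 0 < a)
  (i_gt0 : 0 < i)
  (mE : m = 'C(t, r) - a) (ha : 2 * i + 9 <= a <= t - r + 1)
  (E : {set {set 'I_t}}) (E_rgraph : is_rgraph r E)
  (E_compressed : left_compressed r E) (E_card : #|E| = m)
  (E_least : colex_least (compl_rgraph r E)
     [set k : 'I_t | [|| vlabel k == t - r - i + 1, vlabel k == t - r + 1
                       | t - r + 3 <= vlabel k <= t]]) :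
  (lagrangian R E <= lagrangian R (colex_rgraph t r m))%R.
Proof.
have [s tE] : exists s, t = s + r by exists (t - r); lia.
have sE : t - r = s by rewrite tE addnK.
have ha' : 2 * i + 9 <= a <= s.+1 by move: ha; rewrite sE addn1.
have st : s < t by lia.
have sit : s - i < t by lia.
pose p := Ordinal st; pose b := Ordinal sit.
have AE : [set k : 'I_t | [|| vlabel k == t - r - i + 1, vlabel k == t - r + 1
    | t - r + 3 <= vlabel k <= t]] = p |: (b |: top t s).
  apply/finset.setP => k; rewrite !inE sE /vlabel -!val_eqE /=.
  by have := ltn_ord k; move: ha'; clear; lia.
rewrite AE in E_least.
(* The prescribed non-edge has two distinct elements, [p] and [b], outside [top]. *)
have r2 : 1 < r.
  have /andP[] := E_least; rewrite !inE => /andP[_ /eqP cA] _.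
  have pA : p \notin b |: top t s by rewrite !inE -val_eqE /=;
    move: (i_gt0) ha'; clear; lia.
  have bA : b \notin top t s by rewrite inE /=; move: ha'; clear; lia.
  by move: cA; rewrite !cardsU1 pA bA card_ordseg // tE; clear; lia.
have s1t : s.+1 < t by lia.
pose q := Ordinal s1t.
(* Positivity of [m] rules out truncation in the subtraction defining it. *)
have aC : a < 'C(t, r) by rewrite -subn_gt0 -mE.
have cX : #|compl_rgraph r E| = a.
  by rewrite cardsD (finset.setIidPr E_rgraph) card_rsets E_card mE subKn //
    ltnW.
have XE : compl_rgraph r E = missing s p q a i.
  by apply: (@compl_rgraph_missing t r s p q _ _ _ _ a i E b) => //; lia.
have EE : E = rsets t r :\: missing s p q a i.
  by rewrite -XE /compl_rgraph finset.setDDr finset.setDv finset.set0U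
    (finset.setIidPr E_rgraph).
have [x [xS -> xmax xsort]] : exists x : 'rV[R]_t, [/\ std_simplex x,
    lagrangian R E = lagr E x,
    forall y : 'rV[R]_t, std_simplex y -> (lagr E y <= lagr E x)%R &
    forall u v : 'I_t, u <= v -> (x ord0 v <= x ord0 u)%R].
  apply: lagrangian_max_sorted => // u v S uv uS vS.
  exact: (@left_compressed_shift t r E u v S).
have [z zS [-> zmax]] := lagrangian_max R (colex_rgraph t r m) t_gt0.
apply: Order.POrderTheory.le_trans (zmax _ xS).
rewrite EE in xmax *.
apply: (@Order.POrderTheory.le_trans _ _ (lagr (rsets t r :\: star q (top t s)
  (ordseg t (s.+1 - a) s.+1)) x)).
  exact: (@lagr_missing_le t r s p q tE r2 erefl erefl R a i).
rewrite mE; apply: edge_sum_subset; first by case: xS.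
apply: (@colex_rgraph_sup t r s p q) => //; last exact: ltnW.
by case/andP: ha'.
Qed.
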